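(* Let $f: W(2,2)\times W(2,2)\to W(2,2)$ be a bilinear map. Then $f$ is a biderivation of $W(2,2)$ if and only if there are two complex numbers $\lambda,\mu$ such that $$f(x,y)=\lambda [x,y]+\mu[\omega (x),y]\quad\text{for all } x,y\in W(2,2),$$ where $\omega: W(2,2)\to W(2,2)$ is the linear map defined by $\omega(L_m)=H_m$, $\omega(H_m)=\omega(c)=0$ for all $m\in\mathbb{Z}$.
   Context: All vector spaces are over $\mathbb{C}$. The W-algebra $W(2,2)$ is the complex Lie algebra with basis $\{L_m, H_m, c \mid m\in\mathbb{Z}\}$ and Lie brackets $$[L_m,L_n]=(m-n)L_{m+n}+\tfrac{m^3-m}{12}\delta_{m+n,0}\,c,\quad [L_m,H_n]=(m-n)H_{m+n}+\tfrac{m^3-m}{12}\delta_{m+n,0}\,c,\quad [H_m,H_n]=0,\quad [W(2,2),c]=0$$ for all $m,n\in\mathbb{Z}$ (the same central element $c$ appears in both the first and second brackets). A biderivation of a Lie algebra $L$ is a bilinear map $f:L\times L\to L$ (no skew-symmetry is assumed) satisfying $f([x,y],z)=[x,f(y,z)]+[f(x,z),y]$ and $f(x,[y,z])=[f(x,y),z]+[y,f(x,z)]$ for all $x,y,z\in L$. *)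

(* Defs.v *)
From HB Require Import structures.
From mathcomp Require Import all_boot all_order all_algebra.
From mathcomp Require Import finmap sesquilinear ring.
From mathcomp Require Import monalg.

Set Implicit Arguments.
Unset Strict Implicit.
Unset Printing Implicit Defensive.

Import GRing.Theory Num.Theory.
Local Open Scope ring_scope.

HB.mixin Record Lmodule_isLieAlgebra (K : comNzRingType) L
    of GRing.Lmodule K L := {
  lie_bracket : L -> L -> L;
  lie_bilinear : bilinear_for *:%R *:%R lie_bracket;
  lie_alternating : forall x, lie_bracket x x = 0;
  lie_jacobi : forall x y z,
    lie_bracket x (lie_bracket y z) + lie_bracket y (lie_bracket z x)
      + lie_bracket z (lie_bracket x y) = 0
}.

#[short(type="lieAlgType")]
HB.structure Definition LieAlgebra (K : comNzRingType) :=
  { L of GRing.Lmodule K L & Lmodule_isLieAlgebra K L }.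

Notation "[ 'lie' x , y ]" := (lie_bracket x y)
  (at level 0, format "[ 'lie'  x ,  y ]") : ring_scope.

Definition biderivation (K : comNzRingType) (L : lieAlgType K)
    (f : {bilinear L -> L -> L}) : Prop :=
  (forall x y z, f [lie x, y] z = [lie x, f y z] + [lie f x z, y]) /\
  (forall x y z, f x [lie y, z] = [lie f x y, z] + [lie y, f x z]).

Lemma addrACA3 (V : nmodType) (p q r s t w : V) :
  (p + q) + (r + s) + (t + w) = (p + r + t) + (q + s + w).
Proof. by rewrite (addrACA p) (addrACA (p + r)). Qed.

Section BilinearBracket.
Variables (K : numFieldType) (V : lmodType K) (br : V -> V -> V).
Hypothesis br_bilinear : bilinear_for *:%R *:%R br.

Lemma brPl y a u v : br (a *: u + v) y = a *: br u y + br v y.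
Proof. exact: (br_bilinear.1 y). Qed.

Lemma brPr x a u v : br x (a *: u + v) = a *: br x u + br x v.
Proof. exact: (br_bilinear.2 x). Qed.

Lemma br0l y : br 0 y = 0.
Proof. by have := brPl y (-1) 0 0; rewrite scaler0 addr0 scaleN1r addNr. Qed.

Lemma br0r x : br x 0 = 0.
Proof. by have := brPr x (-1) 0 0; rewrite scaler0 addr0 scaleN1r addNr. Qed.

Lemma brZr x a u : br x (a *: u) = a *: br x u.
Proof. by rewrite -[a *: u]addr0 brPr br0r addr0. Qed.

Lemma brNr x u : br x (- u) = - br x u.
Proof. by rewrite -scaleN1r brZr scaleN1r. Qed.

Definition jacobiator x y z : V :=
  br x (br y z) + br y (br z x) + br z (br x y).

Lemma jacobiator_rot x y z : jacobiator x y z = jacobiator y z x.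
Proof. by rewrite /jacobiator [RHS]addrC addrA. Qed.

Lemma jacobiatorPl y z a u v :
  jacobiator (a *: u + v) y z = a *: jacobiator u y z + jacobiator v y z.
Proof.
by rewrite /jacobiator !(brPl, brPr) addrACA3 !scalerDr.
Qed.

Lemma jacobiator0l y z : jacobiator 0 y z = 0.
Proof. by rewrite /jacobiator !(br0l, br0r) !addr0. Qed.

Section Generators.
Variables (I : Type) (e : I -> V).
Hypothesis e_ind : forall P : V -> Prop,
  P 0 -> (forall a i x, P x -> P (a *: e i + x)) -> forall x, P x.

Lemma bracket_skew :
    (forall i j, br (e j) (e i) = - br (e i) (e j)) ->
  forall x y, br y x = - br x y.
Proof.
move=> skew x y; elim/e_ind: y => [|a i y IHy].
  by rewrite br0l br0r oppr0.
rewrite brPl brPr {}IHy opprD -scalerN; congr (_ *: _ + _).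
elim/e_ind: x => [|b j x IHx]; first by rewrite br0l br0r oppr0.
by rewrite brPl brPr opprD -scalerN IHx skew.
Qed.

Lemma bracket_alternating :
  (forall i j, br (e j) (e i) = - br (e i) (e j)) -> forall x, br x x = 0.
Proof.
move=> /bracket_skew skew x.
have : (2 : K) *: br x x = 0 by rewrite scaler_nat mulr2n {1}skew addNr.
by move/eqP; rewrite scaler_eq0 pnatr_eq0 /= => /eqP.
Qed.

Lemma bracket_jacobi :
    (forall i j k, jacobiator (e i) (e j) (e k) = 0) ->
  forall x y z, jacobiator x y z = 0.
Proof.
have ext y z : (forall i, jacobiator (e i) y z = 0) ->
    forall x, jacobiator x y z = 0.
  move=> jac0; elim/e_ind => [|a i x IHx]; first exact: jacobiator0l.
  by rewrite jacobiatorPl IHx jac0 scaler0 addr0.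
move=> jac x y z; apply: (ext) => i; rewrite jacobiator_rot.
apply: (ext) => j; rewrite jacobiator_rot; apply: (ext) => k.
by rewrite jacobiator_rot.
Qed.

End Generators.

Section W22Relations.
Variables (L H : int -> V) (c : V) (d : int -> int -> K).
Hypothesis dE : forall m n, d m n = (m ^+ 3 - m)%:~R / 12 *+ (m + n == 0).
Hypothesis brC : forall x y, br y x = - br x y.
Hypothesis brLL : forall m n, br (L m) (L n) = (m - n)%:~R *: L (m + n) + d m n *: c.
Hypothesis brLH : forall m n, br (L m) (H n) = (m - n)%:~R *: H (m + n) + d m n *: c.
Hypothesis brHH : forall m n, br (H m) (H n) = 0.
Hypothesis brc : forall x, br x c = 0.

Lemma jacobiatorLX (X : int -> V) m n p :
    (forall m n, br (L m) (X n) = (m - n)%:~R *: X (m + n) + d m n *: c) ->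
  jacobiator (L m) (L n) (X p) = 0.
Proof.
move=> brLX; rewrite /jacobiator.
rewrite (brC (L m) (X p)) !(brLL, brLX) brNr !(brPr, brZr) !brc !scaler0 !addr0.
rewrite (brC (L (m + n)) (X p)) !brLX !dE -scaleNr scalerN -scaleNr.
have -> : n + (m + p) = m + (n + p) by ring.
have -> : m + n + p = m + (n + p) by ring.
set u := X _; set b := _ == 0.
rewrite !scalerDr !scalerA addrACA3 -!scalerDl.
rewrite [X in X *: u](_ : _ = 0).
  rewrite [X in X *: c](_ : _ = 0) ?scale0r ?addr0 //.
  have [/eqP mnp|_] := boolP b; last by rewrite !mulr0n !mulr0 !addr0.
  rewrite !mulr1n !mulrA -!mulrDl -!rmorphN -!rmorphM -!rmorphD /=.
  have -> : m = - n - p by apply/eqP; rewrite -subr_eq0 -mnp; apply/eqP; ring.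
  by set k := (X in X%:~R); have -> : k = 0; [rewrite /k; ring|rewrite mul0r].
rewrite -!rmorphN -!rmorphM -!rmorphD -(rmorph0 intr) /=.
by congr _%:~R; ring.
Qed.

Lemma jacobiatorX (I : Type) (e : I -> V) :
    (forall i, [\/ exists m, e i = L m, exists m, e i = H m | e i = c]) ->
  forall i j k, jacobiator (e i) (e j) (e k) = 0.
Proof.
have jacc x y : jacobiator x y c = 0.
  by rewrite /jacobiator (brC x c) (brC (br x y)) !brc !(br0r, brNr, oppr0, addr0).
have jacLHH p m n : jacobiator (L p) (H m) (H n) = 0.
  rewrite /jacobiator (brC (L p) (H n)) brHH !brLH br0r brNr.
  by rewrite !(brPr, brZr) !brc !brHH !scaler0 !(addr0, oppr0).
have jacHHH p m n : jacobiator (H p) (H m) (H n) = 0.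
  by rewrite /jacobiator !brHH !br0r !addr0.
have jacLLL m n p : jacobiator (L m) (L n) (L p) = 0 by exact: jacobiatorLX.
have jacLLH m n p : jacobiator (L m) (L n) (H p) = 0 by exact: jacobiatorLX.
have jacrot := jacobiator_rot.
move=> eP i j k.
case: (eP i) => [[m ->]|[m ->]|->]; case: (eP j) => [[n ->]|[n ->]|->];
  case: (eP k) => [[p ->]|[p ->]|->]; 
  first [by [] | by rewrite jacrot | by rewrite jacrot jacrot].
Qed.

End W22Relations.
End BilinearBracket.

Section LinearExtension.
Variables (K : comNzRingType) (I : choiceType) (V : lmodType K).

(* The unique linear map sending each basis vector << i >> to h i. *)
Definition lin_ext (h : I -> V) (x : {malg K[I]}) : V :=
  \sum_(i <- msupp x) x@_i *: h i.

Lemma lin_extEw (h : I -> V) (d : {fset I}) (x : {malg K[I]}) :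
  (msupp x `<=` d)%fset -> lin_ext h x = \sum_(i <- d) x@_i *: h i.
Proof.
move=> sxd; rewrite [LHS](big_fset_incl _ sxd) //= => i _ /mcoeff_outdom ->.
by rewrite scale0r.
Qed.

Lemma lin_ext_is_linear (h : I -> V) : linear (lin_ext h).
Proof.
move=> a x y; pose d := (msupp x `|` msupp y `|` msupp (a *: x + y))%fset.
have sx : (msupp x `<=` d)%fset by rewrite /d -fsetUA fsubsetUl.
have sy : (msupp y `<=` d)%fset.
  by rewrite /d (fsetUC (msupp x)) -fsetUA fsubsetUl.
have sxy : (msupp (a *: x + y) `<=` d)%fset by rewrite fsubsetUr.
rewrite (lin_extEw h sx) (lin_extEw h sy) (lin_extEw h sxy).
rewrite scaler_sumr -big_split /=; apply: eq_bigr => i _.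
by rewrite mcoeffD mcoeffZ scalerDl scalerA.
Qed.

HB.instance Definition _ (h : I -> V) :=
  GRing.isLinear.Build K {malg K[I]} V *:%R (lin_ext h) (lin_ext_is_linear h).

Lemma lin_ext_fun_linear (g h : I -> V) (a : K) (x : {malg K[I]}) :
  lin_ext (fun i => a *: g i + h i) x = a *: lin_ext g x + lin_ext h x.
Proof.
rewrite /lin_ext scaler_sumr -big_split /=; apply: eq_bigr => i _.
by rewrite scalerDr !scalerA mulrC.
Qed.

Lemma lin_extU (h : I -> V) (i : I) : lin_ext h << i >> = h i.
Proof.
rewrite (lin_extEw h (d := [fset i]%fset)) ?msuppU_le //.
by rewrite big_seq_fset1 mcoeffUU scale1r.
Qed.

End LinearExtension.

Variant W22_index := W22_iL of int | W22_iH of int | W22_ic.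

Definition W22_index_code (i : W22_index) : (int + int + unit)%type :=
  match i with
  | W22_iL m => inl (inl m) | W22_iH m => inl (inr m) | W22_ic => inr tt
  end.

Definition W22_index_decode (i : (int + int + unit)%type) : W22_index :=
  match i with
  | inl (inl m) => W22_iL m | inl (inr m) => W22_iH m | inr _ => W22_ic
  end.

Lemma W22_index_codeK : cancel W22_index_code W22_index_decode.
Proof. by case. Qed.

HB.instance Definition _ := Choice.copy W22_index (can_type W22_index_codeK).

Section W22.
Variable K : numFieldType.

(* Finitely supported functions on the index set: the vector space with basis
   L_m = << W22_iL m >>, H_m = << W22_iH m >>, c = << W22_ic >>. *)
Definition W22 := {malg K[W22_index]}.
HB.instance Definition _ := GRing.Lmodule.on W22.

Definition W22_L (m : int) : W22 := << W22_iL m >>.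
Definition W22_H (m : int) : W22 := << W22_iH m >>.
Definition W22_c : W22 := << W22_ic >>.

Definition W22_cocycle (m n : int) : K :=
  (m ^+ 3 - m)%:~R / 12 *+ (m + n == 0).

Definition W22_basis_bracket (i j : W22_index) : W22 :=
  match i, j with
  | W22_iL m, W22_iL n =>
      (m - n)%:~R *: W22_L (m + n) + W22_cocycle m n *: W22_c
  | W22_iL m, W22_iH n =>
      (m - n)%:~R *: W22_H (m + n) + W22_cocycle m n *: W22_c
  | W22_iH m, W22_iL n =>
      - ((n - m)%:~R *: W22_H (n + m) + W22_cocycle n m *: W22_c)
  | _, _ => 0
  end.

End W22.

(* Locked only to keep unification from unfolding it. *)
HB.lock Definition W22_bracket (K : numFieldType) (x y : W22 K) : W22 K :=
  lin_ext (fun i => lin_ext (W22_basis_bracket K i) y) x.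

Definition W22_omega (K : numFieldType) (x : W22 K) : W22 K :=
  lin_ext (fun i => if i is W22_iL m then W22_H K m else 0) x.

Section W22Theory.
Variable K : numFieldType.
Local Notation L := (W22_L K).
Local Notation H := (W22_H K).
Local Notation c := (W22_c K).
Local Notation "{[ x , y ]}" := (@W22_bracket K x y).

Lemma W22_elim (P : W22 K -> Prop) :
  P 0 -> (forall a i x, P x -> P (a *: (<< i >> : W22 K) + x)) -> forall x, P x.
Proof.
move=> P0 PD x; rewrite [x]monalgE.
apply: (big_rec P) => // i y _ Py.
have -> : << x@_i *g i >> = x@_i *: << i >> :> W22 K; last exact: PD.
by apply/malgP => j; rewrite mcoeffZ !mcoeffU mulrnAr mulr1.
Qed.

Lemma W22_bracket_bilinear : bilinear_for *:%R *:%R (@W22_bracket K).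
Proof.
split=> [y|x] a u v; rewrite W22_bracket.unlock; first exact: linearP.
rewrite -lin_ext_fun_linear; apply: eq_bigr => i _.
by rewrite linearP.
Qed.

Lemma W22_bracketUU i j :
  W22_bracket (<< i >> : W22 K) << j >> = W22_basis_bracket K i j.
Proof. by rewrite W22_bracket.unlock !lin_extU. Qed.

Lemma W22_bracketLL m n :
  {[L m, L n]} = (m - n)%:~R *: L (m + n) + W22_cocycle K m n *: c.
Proof. exact: W22_bracketUU. Qed.

Lemma W22_bracketLH m n :
  {[L m, H n]} = (m - n)%:~R *: H (m + n) + W22_cocycle K m n *: c.
Proof. exact: W22_bracketUU. Qed.

Lemma W22_bracketHH m n : {[H m, H n]} = 0.
Proof. exact: W22_bracketUU. Qed.

Lemma W22_bracketxc x : {[x, c]} = 0.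
Proof.
elim/W22_elim: x => [|a i x IHx]; first exact: (br0l W22_bracket_bilinear).
rewrite (brPl W22_bracket_bilinear) {}IHx addr0 W22_bracketUU.
by case: i => [m|m|]; rewrite /= scaler0.
Qed.

Lemma W22_cocycleC m n : W22_cocycle K n m = - W22_cocycle K m n.
Proof.
rewrite /W22_cocycle (addrC n m); have [mn|_] := eqVneq (m + n) 0; last first.
  by rewrite !mulr0n oppr0.
have -> : n = - m by apply/eqP; rewrite -addr_eq0 addrC mn.
by rewrite !mulr1n -mulNr -rmorphN; congr (_%:~R / _); ring.
Qed.

Lemma W22_basis_bracketC i j :
  W22_basis_bracket K j i = - W22_basis_bracket K i j.
Proof.
case: i j => [m|m|] [n|n|] //=; rewrite ?oppr0 ?opprK //.
by rewrite W22_cocycleC opprD -!scaleNr -rmorphN opprB (addrC n m).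
Qed.

Lemma W22_bracketxx x : {[x, x]} = 0.
Proof.
apply: (bracket_alternating W22_bracket_bilinear W22_elim) => i j.
by rewrite !W22_bracketUU W22_basis_bracketC.
Qed.

Lemma W22_bracketC x y : {[y, x]} = - {[x, y]}.
Proof.
apply: (bracket_skew W22_bracket_bilinear W22_elim) => i j.
by rewrite !W22_bracketUU W22_basis_bracketC.
Qed.

Lemma W22_bracket_jacobi x y z :
  {[x, {[y, z]}]} + {[y, {[z, x]}]} + {[z, {[x, y]}]} = 0.
Proof.
apply: (bracket_jacobi W22_bracket_bilinear W22_elim) => i j k.
have jac := @jacobiatorX K (W22 K) _ W22_bracket_bilinear L H c
  (W22_cocycle K) (fun _ _ => erefl) W22_bracketC W22_bracketLL W22_bracketLH
  W22_bracketHH W22_bracketxc _ (fun i : W22_index => << i >>).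
by apply: jac => -[m|m|];
  [constructor 1; exists m|constructor 2; exists m|constructor 3].
Qed.

HB.instance Definition _ := Lmodule_isLieAlgebra.Build K (W22 K)
  W22_bracket_bilinear W22_bracketxx W22_bracket_jacobi.

HB.instance Definition _ := GRing.isLinear.Build K (W22 K) (W22 K) *:%R
  (@W22_omega K) (lin_ext_is_linear _).

Lemma W22_omegaL m : W22_omega (L m) = H m.
Proof. exact: lin_extU. Qed.

Lemma W22_omegaH m : W22_omega (H m) = 0.
Proof. exact: lin_extU. Qed.

Lemma W22_omegac : W22_omega c = 0.
Proof. exact: lin_extU. Qed.

End W22Theory.

(* Main.v *)
Require Import Defs.
From HB Require Import structures.
From mathcomp Require Import all_boot all_order all_algebra.
From mathcomp Require Import reals complex sesquilinear monalg.

(** The algebra W(2,2) is graded by the eigenvalues of ad L_0, with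
    [L_0, x] = - n x for x of weight n, and in every nonzero weight n the
    homogeneous space is spanned by L_n and H_n alone.

    The map theta = lambda id + mu omega satisfies
    [theta x, y] = [x, theta y], and theta [x, y] agrees with [theta x, y] up
    to a central element: omega fails to commute with ad x only because it
    kills c.  These two properties are all that is needed for
    (x, y) |-> [theta x, y] to be a biderivation, in any Lie algebra
    ([quasi_centroid_biderivation]).  This is one direction.

    For the converse, let f be a biderivation.  Applying the two Leibniz rules
    to brackets with L_0 and comparing homogeneous components gives integer
    multiples of the components of f(x, y) as brackets with components of
    f(L_0, y) or f(x, L_0), and ultimately of z = f(L_0, L_0).  In weight 1
    the multiple of f(L_1, L_(-k)) is 0, which forces
    [[z_k, L_(-k)], L_1] = 0 and hence z_k = 0 for k <> 0.  So f(x, y) has no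
    component outside the sum of the weights of x and y, provided that one of
    the two integer factors is nonzero; when both vanish the conclusion
    follows from the fact that each weight space is spanned by brackets of
    homogeneous elements of other weights ([weight_generated]).  Thus f
    preserves weights ([bider_homog]).

    Now f(L_1, L_0) has weight 1, so it equals lambda L_1 + mu H_1, which is
    also the value of [theta x, y] at (L_1, L_0).  It remains to see that a
    weight-preserving biderivation g with g(L_1, L_0) = 0 vanishes
    ([bider_eq0]): the relations with L_0 give g(L_1, y) = 0, then that
    g(L_0, y) commutes with L_1, hence that g(L_0, y) = 0, hence g(x, y) = 0,
    for y of weight other than 0 and 1; these weights generate W(2,2).
    Applying this to g = f - [theta -, -] finishes the proof. *)

Set Implicit Arguments.
Unset Strict Implicit.
Unset Printing Implicit Defensive.

Import GRing.Theory Num.Theory.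
Local Open Scope ring_scope.

(** * Lie algebras and biderivations coming from the centroid *)

HB.instance Definition _ (K : comNzRingType) (L : lieAlgType K) :=
  bilinear_isBilinear.Build K L L L *:%R *:%R (@lie_bracket K L)
    (@lie_bilinear K L).

Section LieAlgebra.
Variables (K : comNzRingType) (L : lieAlgType K).
Implicit Types x y z : L.

Lemma lie0l x : [lie 0, x] = 0. Proof. exact: linear0l. Qed.
Lemma lie0r x : [lie x, 0] = 0. Proof. exact: linear0r. Qed.
Lemma lieDl x y z : [lie x + y, z] = [lie x, z] + [lie y, z].
Proof. exact: linearDl. Qed.
Lemma lieDr x y z : [lie x, y + z] = [lie x, y] + [lie x, z].
Proof. exact: linearDr. Qed.
Lemma lieNr x y : [lie x, - y] = - [lie x, y].
Proof. exact: linearNr. Qed.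
Lemma lieBl x y z : [lie x - y, z] = [lie x, z] - [lie y, z].
Proof. exact: linearBl. Qed.
Lemma lieBr x y z : [lie x, y - z] = [lie x, y] - [lie x, z].
Proof. exact: linearBr. Qed.
Lemma lieZl a x y : [lie a *: x, y] = a *: [lie x, y].
Proof. exact: linearZl_LR. Qed.
Lemma lieZr a x y : [lie x, a *: y] = a *: [lie x, y].
Proof. exact: linearZr_LR. Qed.
Lemma liePl a x y z : [lie a *: x + y, z] = a *: [lie x, z] + [lie y, z].
Proof. by rewrite lieDl lieZl. Qed.
Lemma liePr a x y z : [lie x, a *: y + z] = a *: [lie x, y] + [lie x, z].
Proof. by rewrite lieDr lieZr. Qed.

Lemma lieC x y : [lie y, x] = - [lie x, y].
Proof.
have := lie_alternating (x + y).
rewrite lieDl !lieDr !lie_alternating add0r addr0 => /eqP.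
by rewrite addrC addr_eq0 => /eqP.
Qed.

Lemma lie_leibniz x y z :
  [lie x, [lie y, z]] = [lie [lie x, y], z] + [lie y, [lie x, z]].
Proof.
have /eqP := lie_jacobi x y z.
rewrite -addrA addr_eq0 opprD => /eqP ->.
by rewrite (lieC x z) (lieC [lie x, y] z) lieNr !opprK addrC.
Qed.

(** Maps commuting with the adjoint action modulo the centre; the elements of
    the centroid satisfy theta [x, y] = [theta x, y] exactly. *)
Definition quasi_centroid (theta : L -> L) : Prop :=
  (forall x y, [lie theta x, y] = [lie x, theta y]) /\
  (forall x y z, [lie theta [lie x, y], z] = [lie [lie theta x, y], z]).

Lemma quasi_centroid_comb la mu (theta : {linear L -> L}) :
  quasi_centroid theta -> quasi_centroid (la \*: idfun \+ mu \*: theta).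
Proof.
move=> [thetaC thetaM].
split=> [x y|x y z] /=; first by rewrite lieDl lieDr !lieZl !lieZr thetaC.
by rewrite !lieDl !lieZl thetaM.
Qed.

(** This is the Leibniz rule for ad x at [theta y, z]: the extra term
    [theta y, [x, z]] equals [y, theta [x, z]], that is, [y, [theta x, z]]. *)
Lemma quasi_centroid_derivl theta : quasi_centroid theta -> forall x y z,
  [lie theta [lie x, y], z] =
    [lie x, [lie theta y, z]] + [lie [lie theta x, z], y].
Proof.
move=> [thetaC thetaM] x y z.
rewrite thetaM thetaC lie_leibniz -addrA -thetaM.
rewrite [X in _ + X](_ : _ = 0) ?addr0 //.
by rewrite (lieC y) thetaC subrr.
Qed.

Lemma quasi_centroid_biderivation (f : {bilinear L -> L -> L}) theta :
    quasi_centroid theta -> (forall x y, f x y = [lie theta x, y]) ->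
  biderivation f.
Proof.
move=> thetaP fE; split=> x y z; rewrite !fE; last exact: lie_leibniz.
exact: quasi_centroid_derivl.
Qed.

Section Defect.
Variables (f : {bilinear L -> L -> L}) (theta : {linear L -> L}).

Definition defect x y := f x y - [lie theta x, y].

Lemma defect_bilinear : bilinear_for *:%R *:%R defect.
Proof.
split=> [y|x] a u v; rewrite /defect /=.
  by rewrite linearPl linearP lieDl lieZl opprD addrACA scalerBr.
by rewrite linearPr lieDr lieZr opprD addrACA scalerBr.
Qed.

HB.instance Definition _ :=
  bilinear_isBilinear.Build K L L L *:%R *:%R defect defect_bilinear.

Lemma defect_biderivation :
  biderivation f -> quasi_centroid theta -> biderivation defect.
Proof.
move=> [fl fr] /quasi_centroid_derivl thetal; split=> x y z; rewrite /= /defect.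
  by rewrite fl thetal opprD addrACA lieBr lieBl.
by rewrite fr lie_leibniz opprD addrACA lieBr lieBl.
Qed.

End Defect.
End LieAlgebra.

(** * Brackets, omega and the weight grading of W(2,2) *)

Definition weight (i : W22_index) : int :=
  match i with W22_iL m => m | W22_iH m => m | W22_ic => 0 end.

(** Locked, since unification would otherwise unfold it to a finite sum. *)
HB.lock Definition W22_proj (K : numFieldType) (n : int) (x : W22 K) : W22 K :=
  lin_ext (fun i => (<< i >> : W22 K) *+ (weight i == n)) x.

Section W22.
Variable K : numFieldType.
Local Notation W := (W22 K).
Local Notation L := (W22_L K).
Local Notation H := (W22_H K).
Local Notation c := (W22_c K).
Local Notation e i := (<< i >> : W).
Local Notation proj := (@W22_proj K).
Implicit Types (x y z u : W) (m n p k : int) (i j : W22_index).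

Lemma lieUU i j : [lie e i, e j] = W22_basis_bracket K i j.
Proof. exact: W22_bracketUU. Qed.

Lemma lieLL m n :
  [lie L m, L n] = (m - n)%:~R *: L (m + n) + W22_cocycle K m n *: c.
Proof. exact: lieUU. Qed.

Lemma lieLH m n :
  [lie L m, H n] = (m - n)%:~R *: H (m + n) + W22_cocycle K m n *: c.
Proof. exact: lieUU. Qed.

Lemma lieHL m n :
  [lie H m, L n] = (m - n)%:~R *: H (m + n) + W22_cocycle K m n *: c.
Proof.
rewrite lieC lieLH W22_cocycleC opprD scaleNr opprK.
by rewrite -scaleNr -mulrNz opprB (addrC n).
Qed.

Lemma lieHH m n : [lie H m, H n] = 0.
Proof. exact: lieUU. Qed.

Lemma liexc x : [lie x, c] = 0. Proof. exact: W22_bracketxc. Qed.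

Lemma liecx x : [lie c, x] = 0. Proof. by rewrite lieC liexc oppr0. Qed.

Lemma W22_cocycle_neq0 m n : m + n != 0 -> W22_cocycle K m n = 0.
Proof. by rewrite /W22_cocycle => /negbTE ->. Qed.

(** The map omega is abstract here, so that unification cannot unfold it to a
    finite sum. *)
Section Omega.
Variable omega : {linear W -> W}.
Hypothesis omegaL : forall m, omega (L m) = H m.
Hypothesis omegaH : forall m, omega (H m) = 0.
Hypothesis omegac : omega c = 0.

(** Only for e_i = L_m and e_j = L_n with m + n = 0 do omega [e_i, e_j] and
    [omega e_i, e_j] differ, by a multiple of c, which z does not see. *)
Lemma omega_lieUU i j z :
  [lie omega [lie e i, e j], z] = [lie [lie omega (e i), e j], z].
Proof.
case: i j => [m|m|] [n|n|]; rewrite lieUU /=.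
- rewrite linearP linearZ /= omegaL omegac omegaL lieHL scaler0 addr0.
  by rewrite liePl !lieZl liecx scaler0 addr0.
- by rewrite linearP linearZ /= omegaH omegac omegaL lieHH !scaler0 addr0.
- by rewrite linear0 liexc.
- rewrite linearN linearP linearZ /= !omegaH omegac !scaler0 addr0 oppr0.
  by rewrite !lie0l.
- by rewrite linear0 omegaH !lie0l.
- by rewrite linear0 liexc.
- by rewrite linear0 omegac !lie0l.
- by rewrite linear0 omegac !lie0l.
- by rewrite linear0 omegac !lie0l.
Qed.

Lemma quasi_centroid_omega : quasi_centroid omega.
Proof.
split=> [x y|x y z].
  elim/W22_elim: x => [|a i x IHx]; first by rewrite linear0 !lie0l.
  rewrite linearP liePl liePl IHx.
  suff -> : [lie omega (e i), y] = [lie e i, omega y] by [].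
  elim/W22_elim: y {x a IHx} => [|b j y IHy]; first by rewrite linear0 !lie0r.
  rewrite linearP liePr liePr IHy.
  suff -> : [lie omega (e i), e j] = [lie e i, omega (e j)] by [].
  case: i {IHy} j => [m|m|] [n|n|].
  - by rewrite !omegaL lieHL lieLH.
  - by rewrite omegaL omegaH lieHH lie0r.
  - by rewrite omegac lie0r liexc.
  - by rewrite omegaH omegaL lieHH lie0l.
  - by rewrite !omegaH lie0l lie0r.
  - by rewrite omegaH omegac lie0l lie0r.
  - by rewrite omegac lie0l liecx.
  - by rewrite omegac omegaH lie0l lie0r.
  - by rewrite omegac lie0l lie0r.
elim/W22_elim: x => [|a i x IHx]; first by rewrite linear0 !lie0l linear0 lie0l.
rewrite liePl !linearP !liePl IHx.
suff -> : [lie omega [lie e i, y], z] = [lie [lie omega (e i), y], z] by [].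
elim/W22_elim: y {x a IHx} => [|b j y IHy].
  by rewrite !lie0r linear0 lie0l.
by rewrite liePr liePr linearP liePl liePl IHy omega_lieUU.
Qed.

End Omega.

Definition homog n x := [lie L 0, x] = - n%:~R *: x.

Lemma homogU i : homog (weight i) (e i).
Proof.
have cocycle0 m : W22_cocycle K 0 m = 0.
  by rewrite /W22_cocycle expr0n subr0 mul0r mul0rn.
rewrite /homog lieUU; case: i => [m|m|] /=; last by rewrite oppr0 scale0r.
  by rewrite cocycle0 sub0r add0r rmorphN scale0r addr0.
by rewrite cocycle0 sub0r add0r rmorphN scale0r addr0.
Qed.

Lemma homogL0 : homog 0 (L 0).
Proof. exact: homogU (W22_iL 0). Qed.

Lemma homog0 n : homog n 0. Proof. by rewrite /homog lie0r scaler0. Qed.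

Lemma homog_lie m n x y : homog m x -> homog n y -> homog (m + n) [lie x, y].
Proof.
rewrite /homog => hx hy.
by rewrite lie_leibniz hx hy lieZl lieZr -scalerDl -opprD rmorphD.
Qed.

Lemma proj_linear n : linear (proj n).
Proof. by move=> a x y; rewrite W22_proj.unlock linearP. Qed.

HB.instance Definition _ n :=
  GRing.isLinear.Build K W W *:%R (proj n) (proj_linear n).

Lemma proj0 n : proj n 0 = 0. Proof. exact: linear0. Qed.

Lemma projP n a x y : proj n (a *: x + y) = a *: proj n x + proj n y.
Proof. exact: linearP. Qed.

Lemma projD n x y : proj n (x + y) = proj n x + proj n y.
Proof. exact: linearD. Qed.

Lemma projN n x : proj n (- x) = - proj n x.
Proof. exact: linearN. Qed.

Lemma projZ n a x : proj n (a *: x) = a *: proj n x.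
Proof. exact: linearZ. Qed.

Lemma projU n i : proj n (e i) = e i *+ (weight i == n).
Proof. by rewrite W22_proj.unlock lin_extU. Qed.

Lemma mcoeff_proj n x i : (proj n x)@_i = x@_i *+ (weight i == n).
Proof.
elim/W22_elim: x => [|a j x IHx]; first by rewrite proj0 mcoeff0 mul0rn.
rewrite projP !mcoeffD !mcoeffZ IHx projU mulrnDl; congr (_ + _).
rewrite -mulrnAr mcoeffMn !mcoeffU; case: eqP => [->//|_].
by rewrite !mul0rn.
Qed.

Lemma projK n k x : proj k (proj n x) = proj n x *+ (k == n).
Proof.
apply/malgP => i; rewrite mcoeffMn !mcoeff_proj.
by case: eqP => [->|_]; rewrite ?mul0rn // eq_sym.
Qed.

Lemma proj_inj x y : (forall n, proj n x = proj n y) -> x = y.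
Proof.
move=> xy; apply/malgP => i.
by have := congr1 (mcoeff i) (xy (weight i)); rewrite !mcoeff_proj eqxx.
Qed.

Lemma proj_lieL0 n x : proj n [lie L 0, x] = - n%:~R *: proj n x.
Proof.
elim/W22_elim: x => [|a i x IHx]; first by rewrite lie0r proj0 scaler0.
rewrite liePr !projP IHx homogU scalerDr linearZ /= projU.
rewrite !scalerA mulrC; case: eqP => [->//|_].
by rewrite !mulr0n !scaler0.
Qed.

Lemma homog_proj n x : homog n (proj n x).
Proof.
elim/W22_elim: x => [|a i x IHx]; first by rewrite proj0; exact: homog0.
rewrite /homog projP liePr IHx projU scalerDr.
suff -> : a *: [lie L 0, e i *+ (weight i == n)] =
          - n%:~R *: (a *: (e i *+ (weight i == n))) by [].
case: eqP => [<-|_]; last by rewrite mulr0n lie0r !scaler0.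
by rewrite mulr1n homogU !scalerA mulrC.
Qed.

Lemma proj_homog n k x : homog n x -> proj k x = x *+ (k == n).
Proof.
move=> xn; have proj_neq p : p != n -> proj p x = 0.
  move=> pn; have := proj_lieL0 p x; rewrite xn projZ => /eqP.
  rewrite -subr_eq0 -scalerBl scaler_eq0 opprK addrC -intrB intr_eq0 subr_eq0.
  by rewrite (negbTE pn) => /eqP.
have [->|] := eqVneq k n; last exact: proj_neq.
rewrite mulr1n; apply: proj_inj => p; rewrite projK.
by have [->//|/proj_neq] := eqVneq p n.
Qed.

Lemma proj_lie n k u y :
  homog n y -> proj k [lie u, y] = [lie proj (k - n) u, y].
Proof.
move=> yn; elim/W22_elim: u => [|a i u IHu].
  by rewrite lie0l !proj0 lie0l.
rewrite liePl !projP IHu liePl.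
suff -> : proj k [lie e i, y] = [lie proj (k - n) (e i), y] by [].
rewrite (proj_homog _ (homog_lie (homogU i) yn)) projU.
by rewrite [RHS]linearMnl -subr_eq eq_sym.
Qed.

Lemma mcoeffLH a b n i : (a *: L n + b *: H n)@_i =
  a * (W22_iL n == i)%:R + b * (W22_iH n == i)%:R.
Proof.
have coef_comb x y : (a *: x + b *: y)@_i = a * x@_i + b * y@_i.
  by rewrite mcoeffD !mcoeffZ.
by rewrite (coef_comb (L n) (H n)) !mcoeffU.
Qed.

(** The weight 0 is excluded because of c. *)
Lemma homog_span n x :
  n != 0 -> homog n x -> exists a b, x = a *: L n + b *: H n.
Proof.
move=> n0 xn; exists x@_(W22_iL n), x@_(W22_iH n).
have coef i : x@_i = x@_i *+ (weight i == n).
  by rewrite -mcoeff_proj (proj_homog _ xn) eqxx.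
apply/malgP => i.
rewrite mcoeffLH [LHS]coef.
case: i => [m|m|] /=.
- rewrite mulr0 addr0 (_ : (W22_iL n == W22_iL m) = (n == m)) // eq_sym.
  by case: eqVneq => [->|_]; rewrite ?mulr1 // mulr0.
- rewrite mulr0 add0r (_ : (W22_iH n == W22_iH m) = (n == m)) // eq_sym.
  by case: eqVneq => [->|_]; rewrite ?mulr1 // mulr0.
- by rewrite eq_sym (negbTE n0) !mulr0 addr0.
Qed.

Lemma W22_cocycle1 m : W22_cocycle K m 1 = 0.
Proof.
rewrite /W22_cocycle addr_eq0; case: eqP => [->|_]; last exact: mulr0n.
by rewrite (_ : (-1) ^+ 3 - -1 = 0 :> int) // mul0r mul0rn.
Qed.

Lemma lie_LH_L a b m n : [lie a *: L m + b *: H m, L n] =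
  (m - n)%:~R *: (a *: L (m + n) + b *: H (m + n))
    + ((a + b) * W22_cocycle K m n) *: c.
Proof.
have regroup (V : lmodType K) (r d : K) (u v w : V) :
    a *: (r *: u + d *: w) + b *: (r *: v + d *: w)
      = r *: (a *: u + b *: v) + ((a + b) * d) *: w.
  by rewrite !scalerDr addrACA !scalerA -scalerDl mulrDl ![r * _]mulrC.
rewrite liePl lieZl lieLL lieHL; exact: regroup.
Qed.

Lemma LH_free n a b : a *: L n + b *: H n = 0 -> a = 0 /\ b = 0.
Proof.
move=> eq0; split.
  have := congr1 (mcoeff (W22_iL n)) eq0.
  by rewrite mcoeffLH mcoeff0 eqxx mulr0 addr0 mulr1.
have := congr1 (mcoeff (W22_iH n)) eq0.
by rewrite mcoeffLH mcoeff0 eqxx mulr0 add0r mulr1.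
Qed.

Lemma scaler_int_eq0 n u : n != 0 -> n%:~R *: u = 0 :> W -> u = 0.
Proof. by move=> n0 /eqP; rewrite scaler_eq0 intr_eq0 (negbTE n0) => /eqP. Qed.

(** Each basis vector of weight k is a combination of brackets of homogeneous
    elements of weights other than k, so two derivations that agree on those
    weights agree on weight k as well.  For k <> 0 the bracket of weights 2k
    and - k is enough, as 2k - (- k) = 3k is not zero.  For k = 0, the pair of
    weights (1, -1) has zero cocycle and gives L_0 and H_0, and then
    [L_2, L_(-2)] = 4 L_0 + c / 2 gives c. *)
Lemma weight_generated (D : {linear W -> W}) k :
    (forall i j, weight i + weight j = k -> weight i != k -> weight j != k ->
       D [lie e i, e j] = 0) ->
  forall i, weight i = k -> D (e i) = 0.
Proof.
move=> D0.
have eq0 a u : a != 0 -> D (a *: u) = 0 -> D u = 0.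
  by move=> a0; rewrite linearZ => /eqP; rewrite scaler_eq0 (negbTE a0) => /eqP.
have [k0|k0] := eqVneq k 0; last first.
  have ks : k *+ 2 - k = k by rewrite mulr2n addrK.
  have k2 : k *+ 2 != k by rewrite -subr_eq0 ks.
  have kN : - k != k by rewrite eq_sym -addr_eq0 -mulr2n mulrn_eq0.
  have k3 : (k *+ 2 - - k)%:~R != 0 :> K.
    by rewrite opprK -mulrSr intr_eq0 mulrn_eq0.
  case=> [m|m|] /= mk; last by rewrite -mk eqxx in k0.
    have := D0 (W22_iL (k *+ 2)) (W22_iL (- k)) ks k2 kN.
    rewrite lieLL W22_cocycle_neq0 ks // scale0r addr0 mk; exact: eq0.
  have := D0 (W22_iL (k *+ 2)) (W22_iH (- k)) ks k2 kN.
  rewrite lieLH W22_cocycle_neq0 ks // scale0r addr0 mk; exact: eq0.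
have coc1 : W22_cocycle K 1 (-1) = 0.
  by rewrite /W22_cocycle expr1n subrr mul0r mul0rn.
have DL : D (L 0) = 0.
  have := D0 (W22_iL 1) (W22_iL (-1)).
  rewrite k0 lieLL coc1 scale0r addr0 => /(_ erefl erefl erefl).
  by apply: eq0; rewrite intr_eq0.
have DH : D (H 0) = 0.
  have := D0 (W22_iL 1) (W22_iH (-1)).
  rewrite k0 lieLH coc1 scale0r addr0 => /(_ erefl erefl erefl).
  by apply: eq0; rewrite intr_eq0.
rewrite k0; case=> [m /= ->|m /= ->|_] //.
have := D0 (W22_iL 2) (W22_iL (-2)); rewrite k0 lieLL => /(_ erefl erefl erefl).
rewrite linearD linearZ /= [D (W22_L _ _)]DL scaler0 add0r; apply: eq0.
by rewrite /W22_cocycle /= mulr1n mulf_neq0 ?invr_eq0 ?pnatr_eq0.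
Qed.

(** * Biderivations preserve weights *)

Section Biderivation.
Variable f : {bilinear W -> W -> W}.
Hypothesis f_bider : biderivation f.

(** The derivation rule for f([L_0, x], y), in weight p: ad L_0 acts on each
    homogeneous component by a scalar, which isolates the component of
    f(x, y) unless p = m. *)
Lemma proj_biderl m p x y : homog m x ->
  (p - m)%:~R *: proj p (f x y) = [lie proj (p - m) (f (L 0) y), x].
Proof.
move=> xm; rewrite -(proj_lie _ _ xm).
have /(congr1 (proj p)) := f_bider.1 (L 0) x y.
rewrite projD proj_lieL0 xm linearZl_LR projZ => /eqP.
by rewrite addrC -subr_eq -scalerBl opprK addrC -intrB => /eqP.
Qed.

Lemma proj_biderr n p x y : homog n y ->
  (p - n)%:~R *: proj p (f x y) = [lie proj (p - n) (f x (L 0)), y].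
Proof.
move=> yn; rewrite -(proj_lie _ _ yn).
have /(congr1 (proj p)) := f_bider.2 x (L 0) y.
rewrite projD proj_lieL0 yn linearZr_LR projZ => /eqP.
by rewrite -subr_eq -scalerBl opprK addrC -intrB => /eqP.
Qed.

(** In weight 1 the formula for f(L_1, L_(-k)) through f(L_0, L_(-k)) has the
    factor 0 on its left, so that the weight 0 component of f(L_0, L_(-k))
    commutes with L_1.  That component is [z, L_(-k)] / k, where z is the
    weight k component of f(L_0, L_0), and it cannot commute with L_1 if z is
    a nonzero combination of L_k and H_k. *)
Lemma proj_biderL0L0 k : k != 0 -> proj k (f (L 0) (L 0)) = 0.
Proof.
move=> k0.
have [a [b zE]] := homog_span k0 (homog_proj k (f (L 0) (L 0))).
have h1 := @proj_biderl 1 1 (L 1) (L (- k)) (homogU (W22_iL 1)).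
have h2 := @proj_biderr (- k) 0 (L 0) (L (- k)) (homogU (W22_iL (- k))).
rewrite subrr scale0r in h1.
have : [lie [lie a *: L k + b *: H k, L (- k)], L 1] = 0.
  by move: h2; rewrite sub0r opprK zE => <-; rewrite lieZl -h1 scaler0.
rewrite lie_LH_L opprK subrr lieDl (lieZl _ c) liecx scaler0 addr0 lieZl.
rewrite lie_LH_L W22_cocycle1 mulr0 scale0r addr0 sub0r add0r.
have kk : k + k != 0 by rewrite -mulr2n mulrn_eq0.
move=> /(scaler_int_eq0 kk)/(@scaler_int_eq0 (-1) _ isT)/LH_free [a0 b0].
by rewrite zE a0 b0 !scale0r addr0.
Qed.

(** The two formulas through f(L_0, e_i) and f(x, L_0), which have no component
    to contribute in these weights, settle every case except p = m = weight i,
    where both give 0 = 0.  In that case f(x, -) vanishes, in the relevant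
    components, on all weights other than p, and these generate weight p. *)
Lemma proj_bider_eq0 m p x i : homog m x -> p != m + weight i ->
  proj p (f x (e i)) = 0.
Proof.
have L0r n' p' y : homog n' y -> p' != n' -> proj p' (f (L 0) y) = 0.
  move=> yn pn; apply: (@scaler_int_eq0 (p' - n')); first by rewrite subr_eq0.
  by rewrite (proj_biderr _ _ yn) proj_biderL0L0 ?lie0l // subr_eq0.
have L0l m' p' y : homog m' y -> p' != m' -> proj p' (f y (L 0)) = 0.
  move=> yn pn; apply: (@scaler_int_eq0 (p' - m')); first by rewrite subr_eq0.
  by rewrite (proj_biderl _ _ yn) proj_biderL0L0 ?lie0l // subr_eq0.
have offl m' n' p' x' y : homog m' x' -> homog n' y ->
    p' != m' + n' -> p' != m' -> proj p' (f x' y) = 0.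
  move=> xm yn pmn pm; apply: (@scaler_int_eq0 (p' - m')).
    by rewrite subr_eq0.
  by rewrite (proj_biderl _ _ xm) (L0r n') ?lie0l // subr_eq addrC.
have offr m' n' p' x' y : homog m' x' -> homog n' y ->
    p' != m' + n' -> p' != n' -> proj p' (f x' y) = 0.
  move=> xm yn pmn pn; apply: (@scaler_int_eq0 (p' - n')).
    by rewrite subr_eq0.
  by rewrite (proj_biderr _ _ yn) (L0l m') ?lie0l // subr_eq.
set n := weight i => xm pmn; have yn : homog n (e i) := homogU i.
have [pm|] := eqVneq p m; last exact: (offl _ _ _ _ _ xm yn).
have [pn|] := eqVneq p n; last exact: (offr _ _ _ _ _ xm yn).
apply: (@weight_generated (proj p \o f x) p); last exact/esym.
move=> j1 j2 jp j1p j2p; rewrite /= f_bider.2 projD.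
have p0 : p != 0 by move: pmn; rewrite -pm -pn -subr_eq0 opprD addNKr oppr_eq0.
have fxj j : weight j != p -> proj (weight j) (f x (e j)) = 0.
  move=> jp'; apply: (offl _ _ _ _ _ xm (homogU j)); rewrite -pm //.
  by rewrite -subr_eq0 opprD addrCA subrr addr0 oppr_eq0.
rewrite (lieC (f _ _)) projN !(proj_lie _ _ (homogU _)).
rewrite -jp addrK addrAC subrr add0r.
by rewrite !fxj // !lie0l oppr0 addr0.
Qed.

Lemma bider_homog m x i : homog m x -> homog (m + weight i) (f x (e i)).
Proof.
move=> xm; set p := m + _.
suff <- : proj p (f x (e i)) = f x (e i) by exact: homog_proj.
apply: proj_inj => k; rewrite projK.
by have [->//|kp] := eqVneq k p; rewrite (proj_bider_eq0 xm kp).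
Qed.

Lemma weight_biderl m x i : homog m x ->
  (weight i)%:~R *: f x (e i) = [lie f (L 0) (e i), x].
Proof.
move=> xm; have := @proj_biderl m (m + weight i) x (e i) xm.
rewrite addrAC subrr add0r (proj_homog _ (bider_homog i xm)) eqxx.
by have := bider_homog i homogL0; rewrite add0r => /proj_homog ->; rewrite eqxx.
Qed.

Lemma weight_biderr m x i : homog m x ->
  m%:~R *: f x (e i) = [lie f x (L 0), e i].
Proof.
move=> xm; have := @proj_biderr (weight i) (m + weight i) x (e i) (homogU i).
rewrite addrK (proj_homog _ (bider_homog i xm)) eqxx.
have := bider_homog (W22_iL 0) xm.
by rewrite addr0 => /proj_homog ->; rewrite eqxx.
Qed.

(** * The classification *)

(** The vanishing propagates from (L_1, L_0) to (L_1, y), then to (L_0, y) for y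
    of weight n outside 0 and 1: by then f(L_0, y) = a L_n + b H_n commutes
    with L_1, and n - 1 is not zero.  The relation
    n f(x, y) = [f(L_0, y), x] carries it to all x, and the excluded weights
    are recovered by generation, first 1 and then 0. *)
Lemma bider_eq0 : f (L 1) (L 0) = 0 -> forall x y, f x y = 0.
Proof.
move=> fL1.
have L1 : homog 1 (L 1) := homogU (W22_iL 1).
have f1 i : f (L 1) (e i) = 0.
  by have := weight_biderr i L1; rewrite scale1r fL1 lie0l.
have f0 i : weight i != 0 -> weight i != 1 -> f (L 0) (e i) = 0.
  move=> i0 i1; have := bider_homog i homogL0; rewrite add0r.
  move=> /(homog_span i0) [a [b fE]]; have := weight_biderl i L1.
  rewrite f1 scaler0 fE lie_LH_L W22_cocycle1 mulr0 scale0r addr0.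
  move=> /esym/scaler_int_eq0; rewrite subr_eq0 => /(_ i1)/LH_free [-> ->].
  by rewrite !scale0r addr0.
have fx0 i j : weight i != 0 -> weight i != 1 -> f (e j) (e i) = 0.
  move=> i0 i1; apply: (scaler_int_eq0 i0).
  by rewrite (weight_biderl _ (homogU j)) f0 // lie0l.
have fx1 i j : weight i != 0 -> f (e j) (e i) = 0.
  move=> i0; have [i1|] := eqVneq (weight i) 1; last exact: fx0.
  apply: (@weight_generated (f (e j)) 1) => // j1 j2 j12 jn1 jn2.
  have j10 : weight j1 != 0.
    by apply: contraNneq jn2 => j0; rewrite -j12 j0 add0r.
  have j20 : weight j2 != 0.
    by apply: contraNneq jn1 => j0; rewrite -j12 j0 addr0.
  by rewrite /= f_bider.2 !fx0 // lie0l lie0r addr0.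
have fee j i : f (e j) (e i) = 0.
  have [i0|] := eqVneq (weight i) 0; last exact: fx1.
  apply: (@weight_generated (f (e j)) 0) => // j1 j2 _ j1n j2n.
  by rewrite /= f_bider.2 !fx1 // lie0l lie0r addr0.
move=> x y; elim/W22_elim: x => [|a j x IHx]; first exact: linear0l.
rewrite linearPl IHx addr0; elim/W22_elim: y {IHx} => [|b i y IHy].
  by rewrite linear0r scaler0.
by rewrite linearPr fee scaler0 add0r.
Qed.

End Biderivation.

Local Notation omega := (@W22_omega K).

Lemma W22_biderivationP (f : {bilinear W -> W -> W}) :
  biderivation f <-> exists la mu : K, forall x y,
    f x y = la *: [lie x, y] + mu *: [lie omega x, y].
Proof.
have omegaP : quasi_centroid omega.
  exact: quasi_centroid_omega (@W22_omegaL K) (@W22_omegaH K) (W22_omegac K).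
split=> [fP|[la [mu fE]]]; last first.
  have thetaP := quasi_centroid_comb la mu omegaP.
  apply: (quasi_centroid_biderivation thetaP) => x y.
  by rewrite fE lieDl !lieZl.
have [la [mu fE]] : exists la mu, f (L 1) (L 0) = la *: L 1 + mu *: H 1.
  exact: (@homog_span 1 _ isT (bider_homog fP (W22_iL 0) (homogU (W22_iL 1)))).
pose theta : {linear W -> W} := la \*: idfun \+ mu \*: omega.
have gP : biderivation (defect f theta).
  exact: defect_biderivation (quasi_centroid_comb la mu omegaP).
exists la, mu => x y.
have : defect f theta x y = 0.
  apply: (bider_eq0 gP); change (f (L 1) (L 0) - [lie theta (L 1), L 0] = 0).
  have -> : theta (L 1) = la *: L 1 + mu *: H 1 by rewrite /= W22_omegaL.
  rewrite fE lie_LH_L W22_cocycle_neq0 // mulr0 scale0r !addr0.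
  by rewrite scale1r subrr.
by move=> /eqP; rewrite subr_eq0 => /eqP ->; rewrite /theta /= lieDl !lieZl.
Qed.

End W22.

Theorem theorem2p6 (R : realType)
    (f : {bilinear W22 R[i] -> W22 R[i] -> W22 R[i]}) :
  biderivation f <->
  exists lambda mu : R[i], forall x y : W22 R[i],
    f x y = lambda *: [lie x, y] + mu *: [lie W22_omega x, y].
Proof. exact: W22_biderivationP. Qed.
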